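(* Let $(X,p)$ be a complete partial metric space with $X$ nonempty. Let $\phi:[0,\infty)\to[0,\infty)$ be an increasing function such that the function $f(t)=t-\phi(t)$, $t\in[0,\infty)$, is increasing with inverse function $f^{-1}$ right continuous at $0$, and such that $\lim_{n\to\infty}\phi^n(t)=0$ for all $t\ge 0$ (and hence $\phi(0)=0$ and $\phi(t)<t$ for $t>0$). Suppose $T:X\to X$ is a mapping satisfying, for all $x,y\in X$, $$p(Tx,Ty)\le \max\left\{\phi(p(x,y)),\,\frac{p(x,x)+p(y,y)}{2}\right\}.$$ Let $\rho_p=\inf\{p(x,y):x,y\in X\}$ and $X_p=\{x\in X: p(x,x)=\rho_p\}$. Then there is a unique point $z\in X$ such that $Tz=z$. Furthermore, $z\in X_p$, and for each $x\in X_p$ the sequence $\{T^nx\}_{n\ge 1}$ converges to $z$ with respect to the metric $p^s$.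
   Context: A partial metric space is a pair $(X,p)$ with $p:X\times X\to[0,\infty)$ such that for all $x,y,z\in X$: (P1) $p(x,y)=p(y,x)$; (P2) if $p(x,x)=p(x,y)=p(y,y)$ then $x=y$; (P3) $p(x,x)\le p(x,y)$; (P4) $p(x,z)+p(y,y)\le p(x,y)+p(y,z)$. The function $p^s(x,y)=2p(x,y)-p(x,x)-p(y,y)$ is a (usual) metric on $X$. The topology $\tau_p$ on $X$ has as a base the open $p$-balls $B_p(x,\varepsilon)=\{y\in X: p(x,y)<p(x,x)+\varepsilon\}$, $x\in X$, $\varepsilon>0$. A sequence $\{x_n\}$ converges to $x$ in $(X,p)$ (with respect to $\tau_p$) iff $p(x,x)=\lim_{n\to\infty}p(x,x_n)$. A sequence $\{x_n\}$ is Cauchy in $(X,p)$ if $\lim_{n,m\to\infty}p(x_n,x_m)$ exists and is finite. $(X,p)$ is complete if every Cauchy sequence $\{x_n\}$ converges with respect to $\tau_p$ to a point $x\in X$ with $p(x,x)=\lim_{n,m\to\infty}p(x_n,x_m)$. $\phi^n$ and $T^n$ denote $n$-fold iterates; $f^{-1}$ is the inverse function of $f$ (on the range of $f$). *)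

(* Defs.v *)
From mathcomp Require Import all_boot all_order all_algebra.
From mathcomp Require Import all_classical all_reals all_analysis.
Set Implicit Arguments.
Unset Strict Implicit.
Unset Printing Implicit Defensive.
Import Order.TTheory GRing.Theory Num.Theory numFieldNormedType.Exports.
Local Open Scope classical_set_scope.
Local Open Scope ring_scope.

Record is_partial_metric (R : realType) (X : Type) (p : X -> X -> R) : Prop := {
  pm_ge0 : forall x y, 0 <= p x y ;
  pm_sym : forall x y, p x y = p y x ;
  pm_sep : forall x y, p x x = p x y -> p x y = p y y -> x = y ;
  pm_small_self : forall x y, p x x <= p x y ;
  pm_triangle : forall x y z, p x z + p y y <= p x y + p y z }.

Section PartialMetric.
Variables (R : realType) (X : Type) (p : X -> X -> R).

Definition pm_metric (x y : X) : R := 2 * p x y - p x x - p y y.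

Definition pm_ball (x : X) (e : R) : set X := [set y | p x y < p x x + e].

(* the topology having the balls of arbitrary centre and positive radius as a
   base *)
Definition pm_open (U : set X) : Prop :=
  forall y, U y -> exists x e, [/\ 0 < e, pm_ball x e y & pm_ball x e `<=` U].

Definition pm_cvg (u : nat -> X) (x : X) : Prop :=
  forall U, pm_open U -> U x -> \forall n \near \oo, U (u n).

Definition pm_double_lim (u : nat -> X) (l : R) : Prop :=
  (fun nm : nat * nat => p (u nm.1) (u nm.2)) @ filter_prod \oo \oo --> l.

Definition pm_cauchy (u : nat -> X) : Prop := exists l : R, pm_double_lim u l.

Definition pm_complete : Prop := forall u : nat -> X, pm_cauchy u ->
  exists x, pm_cvg u x /\ pm_double_lim u (p x x).

Definition pm_rho : R := inf [set p x y | x in [set: X] & y in [set: X]].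

Definition pm_bottom : set X := [set x | p x x = pm_rho].

Lemma pm_cvgE (u : nat -> X) (x : X) : is_partial_metric p ->
  pm_cvg u x <-> (fun n => p x (u n)) @ \oo --> p x x.
Proof.
move=> pm; split=> [ux|ux U oU Ux].
  apply/cvgrPdist_lt => e e0.
  have : \forall n \near \oo, pm_ball x e (u n).
    apply: ux; last by rewrite /pm_ball /= ltrDl.
    by move=> y xy; exists x, e; split.
  apply: filterS => n; rewrite /pm_ball /= => h.
  rewrite ler0_norm ?subr_le0 ?(pm_small_self pm)//.
  by rewrite opprB ltrBlDl.
have [c [e [e0 cx sU]]] := oU _ Ux.
have d0 : 0 < p c c + e - p c x by rewrite subr_gt0.
move/cvgrPdist_lt : ux => /(_ _ d0); apply: filterS => n.
rewrite ler0_norm ?subr_le0 ?(pm_small_self pm)// opprB => h.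
apply: sU; rewrite /pm_ball /=.
have := pm_triangle pm c x (u n); rewrite -lerBrDr => /le_lt_trans; apply.
by rewrite -addrA addrC -ltrBrDr.
Qed.

End PartialMetric.

(* Main.v *)
Require Import Defs.
From mathcomp Require Import all_boot all_order all_algebra.
From mathcomp Require Import all_classical all_reals all_analysis.
From mathcomp Require Import lra.
Set Implicit Arguments.
Unset Strict Implicit.
Unset Printing Implicit Defensive.
Import Order.TTheory GRing.Theory Num.Theory numFieldNormedType.Exports.
Local Open Scope classical_set_scope.
Local Open Scope ring_scope.

(** The case distinction in the contraction hypothesis is tamed by two facts
about [phi]. Since its iterates vanish, [phi t < t] for [0 < t]; since
[t - phi t] is nondecreasing, this gap is bounded below for [t >= e] by its
positive value at [e]. The first fact makes [T] nonexpansive for [p]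
([T_nonexpansive]); the second is the only quantitative input, and plays the
role of a contraction constant away from [0].

Fix an orbit [u n = T^n x]. Its self-distances decrease to some [r], and
consecutive distances [p (u n) (u n.+1)] decrease too, necessarily to the same
[r]: above [r] only the [phi] branch is available, and each use of it costs a
gap bounded below ([orbit_limit_distances]). Replacing distances by their excess
over [r], the argument of Boyd and Wong then shows that the orbit is Cauchy with
double limit [r], so it has a limit [z] with [p z z = r], and nonexpansiveness
gives [p z (T z) = p z z] ([orbit_limit]). This alone does not make [z] a fixed
point, because [p (T z) (T z)] may be smaller than [p z z].

If however [x] has the least possible self-distance [pm_rho p], then so do [z]
and [T z], and the separation axiom yields [T z = z]; the convergence of the
orbit for [pm_metric] follows because all self-distances are constant
([bottom_orbit_limit]). It remains to find such an [x]. Start orbits at points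
whose self-distance tends to [pm_rho p]; their limits [z k] satisfy
[p (z k) (T (z k)) = p (z k) (z k)], and two such points are at distance at most
slightly more than [pm_rho p], so that the [z k] form a Cauchy sequence, whose
limit has self-distance [pm_rho p] ([bottom_nonempty]). *)

(** * Nonincreasing sequences and comparison functions *)

Lemma nonincreasing_approaches_inf (R : realType) (a : nat -> R) :
  (forall n, 0 <= a n) -> (forall n, a n.+1 <= a n) ->
  exists r, [/\ 0 <= r, forall n, r <= a n &
    forall e, 0 < e -> exists N, forall n, (N <= n)%N -> a n < r + e].
Proof.
move=> a_ge0 a_decr.
have a_inf : has_inf (range a).
  by split; [exists (a 0%N), 0%N | exists 0 => _ [n _ <-]].
exists (inf (range a)); split.
- by apply: lb_le_inf; [exact: a_inf.1 | move=> _ [n _ <-]].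
- by move=> n; apply: ge_inf; [exact: a_inf.2 | exists n].
- move=> e e0; have [_ [N _ <-] aN] := inf_adherent e0 a_inf.
  exists N => n leNn; apply: le_lt_trans aN.
  elim: n leNn => [|n IHn]; first by rewrite leqn0 => /eqP ->.
  rewrite leq_eqVlt => /predU1P[-> //|leNn].
  exact: le_trans (a_decr n) (IHn leNn).
Qed.

Section Comparison.
Variables (R : realType) (phi : R -> R).
Hypothesis phi_ge0 : forall t, 0 <= t -> 0 <= phi t.
Hypothesis phi_incr : forall s t, 0 <= s -> s <= t -> phi s <= phi t.
Hypothesis phi_iter : forall t, 0 <= t -> (fun n => iter n phi t) @ \oo --> 0.

(** If [t <= phi t], monotonicity keeps every iterate above [t]. *)
Lemma comparison_lt t : 0 < t -> phi t < t.
Proof.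
move=> t0; rewrite ltNge; apply/negP => t_le.
have iter_ge n : t <= iter n phi t.
  elim: n => //= n IHn.
  by apply: le_trans t_le _; apply: phi_incr => //; exact: ltW.
have := phi_iter (ltW t0) => /cvgrPdist_lt /(_ t t0) [N _ /(_ N (leqnn N))] /=.
by rewrite sub0r normrN ger0_norm ?ltNge ?iter_ge// (le_trans (ltW t0)).
Qed.

(** Were [s = phi 0] positive, monotonicity would give [s <= phi s], against
[comparison_lt]. *)
Lemma comparison0 : phi 0 = 0.
Proof.
apply/eqP; rewrite eq_le phi_ge0// andbT leNgt; apply/negP => phi0.
have := comparison_lt phi0.
by rewrite ltNge phi_incr// ltW.
Qed.

End Comparison.

(** * Partial metric spaces *)

Section PartialMetricLemmas.
Variables (R : realType) (X : Type) (p : X -> X -> R).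
Hypothesis pm : is_partial_metric p.

Lemma pm_rho_le (x y : X) : pm_rho p <= p x y.
Proof.
apply: ge_inf; last by exists x => //; exists y.
by exists 0 => _ [a _ [b _ <-]]; exact: pm_ge0.
Qed.

Lemma pm_rho_ge0 : inhabited X -> 0 <= pm_rho p.
Proof.
move=> [x]; apply: lb_le_inf.
  by exists (p x x), x => //; exists x.
by move=> _ [a _ [b _ <-]]; exact: pm_ge0.
Qed.

(** The infimum of [p] over all pairs is already approached on the diagonal,
as [p x x <= p x y]. *)
Lemma pm_rho_self_adherent (e : R) : inhabited X -> 0 < e ->
  exists x, p x x < pm_rho p + e.
Proof.
move=> [x0] e0.
have [|_ [x _ [y _ <-]] xy] := @inf_adherent R
    [set p x y | x in [set: X] & y in [set: X]] e e0.
  split; first by exists (p x0 x0), x0 => //; exists x0.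
  by exists 0 => _ [a _ [b _ <-]]; exact: pm_ge0.
by exists x; apply: le_lt_trans xy; exact: pm_small_self.
Qed.

(** The form in which completeness is used: the double limit is a known lower
bound of the distances, so only one-sided estimates are needed. *)
Lemma pm_complete_limit (u : nat -> X) (r : R) : pm_complete p ->
  (forall n m, r <= p (u n) (u m)) ->
  (forall e, 0 < e -> exists N, forall n m, (N <= n)%N -> (N <= m)%N ->
     p (u n) (u m) <= r + e) ->
  exists2 z, p z z = r & (fun n => p z (u n)) @ \oo --> r.
Proof.
move=> pcomplete r_le u_small.
have u_lim : pm_double_lim p u r.
  apply/cvgrPdist_le => e e0; have [N uN] := u_small e e0.
  exists ([set n | (N <= n)%N], [set n | (N <= n)%N]).
    by split; exists N.
  move=> [n m] /= [leNn leNm]; rewrite distrC ger0_norm ?subr_ge0//.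
  by rewrite lerBlDl; exact: uN.
have [z [uz zlim]] := pcomplete u (ex_intro _ r u_lim).
have zz : p z z = r by exact: (cvg_unique _ zlim u_lim).
by exists z => //; rewrite -[X in _ --> X]zz; exact/(pm_cvgE u z pm).
Qed.

End PartialMetricLemmas.

(** * Consequences of the contraction condition *)

Section Contraction.
Variables (R : realType) (X : Type) (p : X -> X -> R).
Hypotheses (pm : is_partial_metric p) (pcomplete : pm_complete p).
Variable phi : R -> R.
Hypothesis phi_incr : forall s t, 0 <= s -> s <= t -> phi s <= phi t.
Hypothesis phi_lt : forall t, 0 < t -> phi t < t.
Hypothesis phi0 : phi 0 = 0.
Hypothesis gap_incr :
  forall s t, 0 <= s -> s <= t -> s - phi s <= t - phi t.
Variable T : X -> X.
Hypothesis T_contr : forall x y,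
  p (T x) (T y) <= Num.max (phi (p x y)) ((p x x + p y y) / 2).

Lemma self_avg_le x y : (p x x + p y y) / 2 <= p x y.
Proof.
have := pm_small_self pm x y; have := pm_small_self pm y x.
rewrite (pm_sym pm y x); lra.
Qed.

Lemma T_contr_cases x y :
  p (T x) (T y) <= phi (p x y) \/ p (T x) (T y) <= (p x x + p y y) / 2.
Proof. by have := T_contr x y; rewrite le_max => /orP[]; [left|right]. Qed.

(** Both terms of the maximum are at most [p x y]: the first since [phi t <= t],
the second since self-distances are small. *)
Lemma T_nonexpansive x y : p (T x) (T y) <= p x y.
Proof.
have [le_phi|le_avg] := T_contr_cases x y; last first.
  exact: le_trans le_avg (self_avg_le x y).
apply: le_trans le_phi _; have := pm_ge0 pm x y.
rewrite le_eqVlt => /predU1P[<-|/phi_lt /ltW //]; by rewrite phi0.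
Qed.

(** For fixed points the strict inequality [phi t < t] rules out the first branch
unless [p w z = 0]; in all cases [p w z] is at most the average of the
self-distances, which forces the three numbers to coincide. *)
Lemma T_fixed_unique z w : T z = z -> T w = w -> w = z.
Proof.
move=> Tz Tw; have := T_contr_cases w z; rewrite Tz Tw => cases.
have wz := pm_small_self pm w z.
have := pm_small_self pm z w; rewrite (pm_sym pm z w) => zw.
have : p w z <= (p w w + p z z) / 2.
  case: cases => // le_phi.
  have := pm_ge0 pm w z; rewrite le_eqVlt => /predU1P[wz0|/phi_lt]; last lra.
  by have := pm_ge0 pm w w; have := pm_ge0 pm z z; lra.
by move=> le_avg; apply: (pm_sep pm); lra.
Qed.

(** If [T] shrinks [p x y] by at most [eta], the [phi] branch forces the gap at
[p x y] to be at most [eta], hence smaller than the gap at [e]; since the gap is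
nondecreasing, [p x y <= e]. *)
Lemma close_of_almost_fixed x y e eta : 0 < e -> eta < e - phi e ->
  p x y <= p (T x) (T y) + eta ->
  p x y <= Num.max e ((p x x + p y y) / 2 + eta).
Proof.
move=> e0 eta_lt xy; rewrite le_max.
have [le_phi|le_avg] := T_contr_cases x y; last by apply/orP; right; lra.
apply/orP; left; rewrite leNgt; apply/negP => e_lt.
have := gap_incr (ltW e0) (ltW e_lt); lra.
Qed.

(** * Convergence of orbits *)

Section Orbit.
Variable x : X.
Let u n := iter n T x.

(** Self-distances and consecutive distances along an orbit decrease to the same
limit. Let [c] be the infimum of the latter and suppose [r < c]. Once
[p (u n) (u n.+1)] is within [c - phi c] of [c], the [phi] branch would lower it
below [c], while the averaging branch would bring it below [c] as soon as
[p (u n) (u n) < c]. *)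
Lemma orbit_limit_distances : exists r,
  [/\ 0 <= r, forall n, r <= p (u n) (u n) &
    forall e, 0 < e -> exists N, forall n, (N <= n)%N ->
      p (u n) (u n) < r + e /\ p (u n) (u n.+1) < r + e].
Proof.
have [||r [r0 r_le r_lim]] := @nonincreasing_approaches_inf R
  (fun n => p (u n) (u n)).
- by move=> n; exact: pm_ge0.
- by move=> n; exact: T_nonexpansive.
have [||c [c0 c_le c_lim]] := @nonincreasing_approaches_inf R
  (fun n => p (u n) (u n.+1)).
- by move=> n; exact: pm_ge0.
- by move=> n; exact: T_nonexpansive.
have c_le_r : c <= r.
  rewrite leNgt; apply/negP => rc.
  have cpos : 0 < c by exact: le_lt_trans rc.
  have gap : 0 < c - phi c by rewrite subr_gt0 phi_lt.
  have [N1 HN1] := r_lim (c - r) ltac:(by rewrite subr_gt0).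
  have [N2 HN2] := c_lim (c - phi c) gap.
  pose n := maxn N1 N2.
  have pn := HN1 n (leq_maxl _ _); have cn := HN2 n (leq_maxr _ _).
  have pn1 : p (u n.+1) (u n.+1) <= p (u n) (u n) by exact: T_nonexpansive.
  have := c_le n.+1; have := gap_incr c0 (c_le n).
  have : p (u n.+1) (u n.+2) <= phi (p (u n) (u n.+1)) \/
    p (u n.+1) (u n.+2) <= (p (u n) (u n) + p (u n.+1) (u n.+1)) / 2.
    exact: T_contr_cases.
  by case; lra.
exists r; split=> // e e0.
have [N1 HN1] := r_lim e e0; have [N2 HN2] := c_lim e e0.
exists (maxn N1 N2) => n; rewrite geq_max => /andP[le1 le2].
by split; [exact: HN1|have := HN2 n le2; lra].
Qed.

Lemma orbit_self_decr n m : (n <= m)%N -> p (u m) (u m) <= p (u n) (u n).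
Proof.
move/subnK <-; elim: (m - n)%N => //= k IHk.
exact: le_trans (T_nonexpansive _ _) IHk.
Qed.

(** The bound [p (u n) (u (k + n)) <= r + e] propagates from [k] to [k.+1] by the
triangle inequality through [u n.+1]: the detour costs
[p (u n) (u n.+1) - p (u n.+1) (u n.+1)], which tends to [0], while applying [T]
gains the gap at [r + e] or falls back on self-distances close to [r].
Bounding the whole orbit first, by solving [M - phi M = p x (T x)], would fail
when [t - phi t] is a bounded function of [t]. *)
Lemma orbit_limit : exists z, [/\ p z z <= p x x, p z (T z) = p z z &
  (fun n => p z (u n)) @ \oo --> p z z].
Proof.
have [r [r0 r_le r_lim]] := orbit_limit_distances.
have r_dist n m : r <= p (u n) (u m).
  exact: le_trans (r_le n) (pm_small_self pm _ _).
have u_small e : 0 < e -> exists N, forall n m, (N <= n)%N -> (N <= m)%N ->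
    p (u n) (u m) <= r + e.
  move=> e0; have re0 : 0 < r + e by lra.
  have gap : 0 < r + e - phi (r + e) by rewrite subr_gt0 phi_lt.
  (* [d] bounds the cost of the detour; the gap at [r + e] absorbs it in the
     [phi] branch, and in the averaging branch the total is below [r + 2 d]. *)
  pose d := Num.min (e / 2) (r + e - phi (r + e)).
  have d0 : 0 < d by rewrite lt_min gap andbT; lra.
  have [d_e d_gap] : d <= e / 2 /\ d <= r + e - phi (r + e).
    by split; rewrite ge_min lexx ?orbT.
  have [N HN] := r_lim d d0.
  suff ordered n k : (N <= n)%N -> p (u n) (u (k + n)%N) <= r + e.
    exists N => n m leNn leNm; case: (leqP n m) => [/subnK <-|/ltnW /subnK <-].
      exact: ordered.
    by rewrite pm_sym//; exact: ordered.
  move=> leNn; have [pn cn] := HN n leNn.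
  elim: k => [|k IHk]; first by rewrite add0n; lra.
  have pk : p (u (k + n)%N) (u (k + n)%N) <= p (u n) (u n).
    exact: orbit_self_decr (leq_addl _ _).
  have := pm_triangle pm (u n) (u n.+1) (u (k + n).+1).
  have := r_le n.+1.
  have := phi_incr (pm_ge0 pm _ _) IHk.
  have : p (u n.+1) (u (k + n).+1) <= phi (p (u n) (u (k + n)%N)) \/
    p (u n.+1) (u (k + n).+1) <=
      (p (u n) (u n) + p (u (k + n)%N) (u (k + n)%N)) / 2.
    exact: T_contr_cases.
  by rewrite addSn; case; lra.
have [z zz uz] := pm_complete_limit pm pcomplete r_dist u_small.
exists z; rewrite zz; split=> //; first exact: (r_le 0%N).
apply/le_anti/andP; split; last by rewrite -zz; exact: pm_small_self.
apply/ler_addgt0Pr => e e0.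
have e20 : 0 < e / 2 by lra.
(* Compare [z] and [T z] through [u N.+1], using
   [p (T z) (u N.+1) <= p z (u N)]. *)
move/cvgrPdist_lt : uz => /(_ _ e20) [N _ HN].
have zu n : (N <= n)%N -> p z (u n) < r + e / 2.
  by move=> /HN /=; rewrite ltr_norml => /andP[]; lra.
have := zu N (leqnn N); have := zu N.+1 (leqnSn N).
have : p (T z) (u N.+1) <= p z (u N) by exact: T_nonexpansive.
have := pm_triangle pm z (u N.+1) (T z); rewrite (pm_sym pm (u N.+1)).
have := r_le N.+1; lra.
Qed.

End Orbit.

(** * Points of least self-distance *)

Hypothesis Xnonempty : inhabited X.

(** The limits [z k] of orbits started at almost minimal self-distance satisfy
[p (z k) (T (z k)) = p (z k) (z k)], so passing from [(z n, z m)] to their images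
costs only the excesses of their self-distances over [pm_rho p]; hence
[close_of_almost_fixed] applies to them. *)
Lemma bottom_nonempty : exists x, pm_bottom p x.
Proof.
have rho0 := pm_rho_ge0 pm Xnonempty.
have /choice[z zP] k : exists z,
    p z z < pm_rho p + k.+1%:R^-1 /\ p z (T z) = p z z.
  have k0 : 0 < k.+1%:R^-1 :> R by [].
  have [x xk] := pm_rho_self_adherent pm Xnonempty k0.
  by have [z [zx zT _]] := orbit_limit x; exists z; split=> //; exact: le_lt_trans xk.
have z_small e : 0 < e -> exists N, forall n m, (N <= n)%N -> (N <= m)%N ->
    p (z n) (z m) <= pm_rho p + e.
  move=> e0; have re0 : 0 < pm_rho p + e by lra.
  have gap : 0 < pm_rho p + e - phi (pm_rho p + e) by rewrite subr_gt0 phi_lt.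
  (* The two excesses add up to less than [2 d], and the averaging branch
     contributes one more [d] to the bound. *)
  pose d := Num.min (e / 3) ((pm_rho p + e - phi (pm_rho p + e)) / 3).
  have d0 : 0 < d by rewrite lt_min; apply/andP; split; lra.
  have [d_e d_gap] : d <= e / 3 /\
      d <= (pm_rho p + e - phi (pm_rho p + e)) / 3.
    by split; rewrite ge_min lexx ?orbT.
  have [N _ HN] : \forall n \near \oo, n.+1%:R^-1 < d.
    by exact: near_infty_natSinv_lt (PosNum d0).
  exists N => n m /HN /= dn /HN /= dm.
  have [zn Tn] := zP n; have [zm Tm] := zP m.
  have {}zn : p (z n) (z n) < pm_rho p + d.
    by apply: lt_trans zn _; rewrite ltrD2l.
  have {}zm : p (z m) (z m) < pm_rho p + d.
    by apply: lt_trans zm _; rewrite ltrD2l.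
  have rn := pm_rho_le pm (T (z n)) (T (z n)).
  have rm := pm_rho_le pm (T (z m)) (T (z m)).
  have tri1 := pm_triangle pm (z n) (T (z n)) (z m).
  have := pm_triangle pm (T (z n)) (T (z m)) (z m).
  rewrite (pm_sym pm (T (z m)) (z m)) => tri2.
  have close : p (z n) (z m) <= p (T (z n)) (T (z m)) + 2 * d by lra.
  have := close_of_almost_fixed re0 _ close.
  move=> /(_ ltac:(lra)); rewrite le_max => /orP[//|]; lra.
have [y yy _] := pm_complete_limit pm pcomplete
  (fun n m => pm_rho_le pm (z n) (z m)) z_small.
by exists y.
Qed.

Lemma bottom_stable x : pm_bottom p x -> pm_bottom p (T x).
Proof.
move=> bx; apply/le_anti/andP; split; last exact: pm_rho_le.
by rewrite -bx; exact: T_nonexpansive.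
Qed.

(** On points of least self-distance the limit [z] of the orbit satisfies
[p z z = p z (T z) = p (T z) (T z)], so it is fixed. *)
Lemma bottom_orbit_limit x : pm_bottom p x -> exists z,
  [/\ T z = z, pm_bottom p z &
    (fun n => pm_metric p (iter n T x) z) @ \oo --> 0].
Proof.
move=> bx; have [z [zx zT uz]] := orbit_limit x.
have bz : pm_bottom p z.
  by apply/le_anti/andP; split; [rewrite -bx|exact: pm_rho_le].
exists z; split=> //.
  apply/esym/(pm_sep pm); first by rewrite zT.
  by rewrite zT (bottom_stable bz).
have bu n : pm_bottom p (iter n T x).
  by elim: n => //= n; exact: bottom_stable.
have -> : (fun n => pm_metric p (iter n T x) z) =
    (fun n => 2 * p z (iter n T x) - (p z z + p z z)).
  by apply/funext => n; rewrite /pm_metric (bu n) bz (pm_sym pm z) opprD addrA.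
have -> : 0 = 2 * p z z - (p z z + p z z) :> R by lra.
by apply: cvgB; [apply: cvgMr|exact: cvg_cst].
Qed.

End Contraction.

Theorem theorem3 (R : realType) (X : Type) (p : X -> X -> R)
    (pm : is_partial_metric p) (pcomplete : pm_complete p)
    (Xnonempty : inhabited X)
    (phi : R -> R) (phi_ge0 : forall t, 0 <= t -> 0 <= phi t)
    (phi_incr : forall s t, 0 <= s -> s <= t -> phi s <= phi t)
    (f : R -> R) (fE : forall t, 0 <= t -> f t = t - phi t)
    (f_incr : forall s t, 0 <= s -> s <= t -> f s <= f t)
    (finv : R -> R) (finvK : forall t, 0 <= t -> finv (f t) = t)
    (finv_rcont :
      finv @ within (f @` [set t | 0 <= t]) (at_right 0) --> finv 0)
    (phi_iter : forall t, 0 <= t -> (fun n => iter n phi t) @ \oo --> 0)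
    (T : X -> X)
    (T_contr : forall x y,
      p (T x) (T y) <= Num.max (phi (p x y)) ((p x x + p y y) / 2)) :
  exists z : X,
    [/\ T z = z,
        forall w, T w = w -> w = z,
        pm_bottom p z &
        forall x, pm_bottom p x ->
          (fun n => pm_metric p (iter n T x) z) @ \oo --> 0].
Proof.
have phi_lt := comparison_lt phi_incr phi_iter.
have phi0 := comparison0 phi_ge0 phi_incr phi_iter.
have gap_incr s t : 0 <= s -> s <= t -> s - phi s <= t - phi t.
  by move=> s0 st; rewrite -!fE ?f_incr// (le_trans s0).
have unique := T_fixed_unique pm phi_lt T_contr.
have limit := bottom_orbit_limit pm pcomplete phi_incr phi_lt phi0
  gap_incr T_contr.
have [x bx] := bottom_nonempty pm pcomplete phi_incr phi_lt phi0 gap_incr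
  T_contr Xnonempty.
have [z [Tz bz _]] := limit x bx.
exists z; split=> // [w Tw|y /limit[w [Tw _ yw]]]; first exact: unique.
by rewrite -(unique z w).
Qed.
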